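(* Let $\boldsymbol{\Upsilon}$ and $\boldsymbol{\Xi}$ be complex symmetric $m\times m$ matrices with $\operatorname{Re}(\boldsymbol{\Xi})>\mathbf{0}$, let $a_1,\dots,a_p,b_1,\dots,b_q$ be real or complex constants, and let $\operatorname{Re}(a)>(m-1)/2$. Assume that the random $m\times m$ matrix $\mathbf{Y}>\mathbf{0}$ has a matrix variate hypergeometric gamma type distribution with these parameters. Then $\mathbf{P}=\mathbf{Y}^{-1}$ has density function $$f_{\mathbf{P}}(\mathbf{P})=\frac{|\boldsymbol{\Xi}|^{a}}{\Gamma_m[a]\;{}_{p+1}F_q(a_1,\dots,a_p,a;b_1,\dots,b_q;\boldsymbol{\Upsilon}\boldsymbol{\Xi}^{-1})}\;\operatorname{etr}\{-\boldsymbol{\Xi}\mathbf{P}^{-1}\}\,|\mathbf{P}|^{-a-(m+1)/2}\;{}_pF_q(a_1,\dots,a_p;b_1,\dots,b_q;\boldsymbol{\Upsilon}\mathbf{P}^{-1}),\quad\mathbf{P}>\mathbf{0}$$ (the matrix variate inverted hypergeometric gamma type distribution).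
   Context: Notation: $\mathbf{A}>\mathbf{0}$ means $\mathbf{A}$ is (real symmetric) positive definite, $|\mathbf{A}|$ is the determinant, $\operatorname{etr}\{\mathbf{A}\}=\exp(\operatorname{tr}\mathbf{A})$. Densities are with respect to Lebesgue measure on the cone of $m\times m$ positive definite matrices, with the $m(m+1)/2$ functionally independent entries as coordinates. For complex symmetric $\mathbf{A}$ with positive definite real part, powers $|\mathbf{A}|^{s}$ are taken on the branch that is positive when $\mathbf{A}$ and $s$ are real. Multivariate gamma function: $\Gamma_m[a]=\pi^{m(m-1)/4}\prod_{i=1}^m\Gamma[a-(i-1)/2]$, $\operatorname{Re}(a)>(m-1)/2$. Hypergeometric functions of matrix argument: $${}_pF_q(a_1,\dots,a_p;b_1,\dots,b_q;\mathbf{Y})=\sum_{k=0}^\infty\sum_{\kappa}\frac{(a_1)_\kappa\cdots(a_p)_\kappa}{(b_1)_\kappa\cdots(b_q)_\kappa}\,\frac{C_\kappa(\mathbf{Y})}{k!},$$ where the inner sum is over $\kappa=(k_1,\dots,k_m)$ with integers $k_1\ge\cdots\ge k_m\ge0$, $k_1+\cdots+k_m=k$; $(a)_\kappa=\prod_{i=1}^m(a-(i-1)/2)_{k_i}$ with $(x)_r=x(x+1)\cdots(x+r-1)$, $(x)_0=1$; and $C_\kappa(\mathbf{Y})$ is the zonal polynomial (normalized by $\sum_\kappa C_\kappa(\mathbf{Y})=(\operatorname{tr}\mathbf{Y})^k$), a symmetric homogeneous polynomial of degree $k$ in the eigenvalues of $\mathbf{Y}$, so that it is also defined at products such as $\boldsymbol{\Upsilon}\mathbf{P}^{-1}$.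 It is understood that the parameters are such that the hypergeometric series occurring are well defined and convergent. Matrix variate hypergeometric gamma type distribution (Roux): $\mathbf{Y}>\mathbf{0}$ has this distribution if its probability density is $$f_{\mathbf{Y}}(\mathbf{Y})=\frac{|\boldsymbol{\Xi}|^{a}}{\Gamma_m[a]\;{}_{p+1}F_q(a_1,\dots,a_p,a;b_1,\dots,b_q;\boldsymbol{\Upsilon}\boldsymbol{\Xi}^{-1})}\;\operatorname{etr}\{-\boldsymbol{\Xi}\mathbf{Y}\}\,|\mathbf{Y}|^{a-(m+1)/2}\;{}_pF_q(a_1,\dots,a_p;b_1,\dots,b_q;\boldsymbol{\Upsilon}\mathbf{Y}),\quad\mathbf{Y}>\mathbf{0}.$$ *)

(* Defs.v *)
Set Warnings "-all".
From HB Require Import structures.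
From mathcomp Require Import all_boot all_order all_algebra.
From mathcomp Require Import boolp classical_sets.
From mathcomp Require Import complex.
From mathcomp Require mpoly.

Set Implicit Arguments.
Unset Strict Implicit.
Unset Printing Implicit Defensive.

Import Order.TTheory GRing.Theory Num.Theory.
Local Open Scope ring_scope.
Local Open Scope complex_scope.

(* The notations of mpoly and of MathComp-Analysis cannot be loaded together:
   everything that mentions multivariate polynomials is in this module, which
   precedes the import of MathComp-Analysis. *)
Module Zonal.
Import mpoly.

(* A monomial exponent kappa : 'X_{1..m} is a function 'I_m -> nat; it encodes
   a partition of mdeg kappa into at most m parts when it is nonincreasing. *)
Definition is_partition (m : nat) (kappa : 'X_{1..m}) : bool :=
  [forall i : 'I_m, forall j : 'I_m, (i <= j)%N ==> (kappa j <= kappa i)%N].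

Definition dominated (m : nat) (lam kappa : 'X_{1..m}) : Prop :=
  forall r : nat,
    (\sum_(i < m | (i < r)%N) lam i <= \sum_(i < m | (i < r)%N) kappa i)%N.

(* sum_i y_i^2 d^2/dy_i^2 + sum_(i <> j) y_i^2 / (y_i - y_j) d/dy_i, applied to
   p at a point y with distinct coordinates. *)
Definition laplace_beltrami (K : fieldType) (m : nat) (p : {mpoly K[m]})
    (y : 'I_m -> K) : K :=
  \sum_i y i ^+ 2 * (p^`M(i)^`M(i)).@[y] +
  \sum_i \sum_(j | j != i) y i ^+ 2 / (y i - y j) * (p^`M(i)).@[y].

(* The definition of Muirhead, "Aspects of Multivariate Statistical Theory",
   section 7.2. Lower weight is meant for the dominance order and not for the
   lexicographic one: distinct partitions, such as (4,1,1) and (3,3), may have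
   the same eigenvalue, and only for the dominance order is the family unique. *)
Record is_zonal (K : fieldType) (m : nat) (Z : 'X_{1..m} -> {mpoly K[m]}) :
    Prop := IsZonal {
  zonal_sym : forall kappa, is_partition kappa -> Z kappa \is symmetric;
  zonal_homog : forall kappa, is_partition kappa ->
    Z kappa \is (mdeg kappa).-homog;
  zonal_lead : forall kappa, is_partition kappa -> (Z kappa)@_kappa != 0;
  zonal_weight : forall kappa lam, is_partition kappa -> is_partition lam ->
    (Z kappa)@_lam != 0 -> dominated lam kappa;
  zonal_eigen : forall kappa, is_partition kappa ->
    exists c : K, forall y : 'I_m -> K, injective y ->
      laplace_beltrami (Z kappa) y = c * (Z kappa).@[y];
  zonal_trace : forall k : nat,
    \sum_(kappa : 'X_{1..m < k.+1}
            | is_partition kappa && (mdeg kappa == k)) Z kappa =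
    (\sum_i 'X_i) ^+ k }.

Definition zonal (K : fieldType) (m : nat) : 'X_{1..m} -> {mpoly K[m]} :=
  xget (fun=> 0) [set Z | @is_zonal K m Z]%classic.

Definition eigenvalues (K : closedFieldType) (m : nat) (A : 'M[K]_m) : seq K :=
  sval (closed_field_poly_normal (char_poly A)).

Definition zonal_mx (K : closedFieldType) (m : nat) (kappa : 'X_{1..m})
    (A : 'M[K]_m) : K :=
  (zonal K kappa).@[fun i : 'I_m => (eigenvalues A)`_i].

Definition pochhammer (K : fieldType) (x : K) (r : nat) : K :=
  \prod_(i < r) (x + i%:R).

Definition gen_pochhammer (K : fieldType) (m : nat) (x : K)
    (kappa : 'X_{1..m}) : K :=
  \prod_(i < m) pochhammer (x - i%:R / 2) (kappa i).

Definition hypergeom_coef (K : fieldType) (m : nat) (aa bb : seq K)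
    (kappa : 'X_{1..m}) : K :=
  (\prod_(a <- aa) gen_pochhammer a kappa) /
  (\prod_(b <- bb) gen_pochhammer b kappa).

Definition hypergeom_term (K : closedFieldType) (m : nat) (aa bb : seq K)
    (A : 'M[K]_m) (k : nat) : K :=
  \sum_(kappa : 'X_{1..m < k.+1} | is_partition kappa && (mdeg kappa == k))
    hypergeom_coef aa bb kappa * zonal_mx kappa A / k`!%:R.

(* No denominator (b_1)_kappa ... (b_q)_kappa of the series vanishes. *)
Definition hypergeom_defined (K : fieldType) (m : nat) (bb : seq K) : Prop :=
  forall (b : K) (kappa : 'X_{1..m}),
    b \in bb -> is_partition kappa -> gen_pochhammer b kappa != 0.

End Zonal.

From mathcomp Require Import all_classical all_reals all_analysis.
Import numFieldNormedType.Exports.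
Import Zonal.
Local Open Scope classical_set_scope.

(* R[i] has its topology on the alias R[i]^o. *)
Definition hypergeom_cvg (R : realType) (m : nat) (aa bb : seq R[i])
    (A : 'M[R[i]]_m) : Prop :=
  cvgn (series (hypergeom_term aa bb A : nat -> R[i]^o)).

Definition hypergeom (R : realType) (m : nat) (aa bb : seq R[i])
    (A : 'M[R[i]]_m) : R[i] :=
  limn (series (hypergeom_term aa bb A : nat -> R[i]^o)).

Definition cexp (R : realType) (z : R[i]) : R[i] :=
  (expR (complex.Re z))%:C * (cos (complex.Im z) +i* sin (complex.Im z)).

(* x ^ s for x > 0; it is also the power |A|^s of a real A > 0, at x = \det A. *)
Definition rcpow (R : realType) (x : R) (s : R[i]) : R[i] :=
  cexp (s * (ln x)%:C).

Definition etr (R : realType) (m : nat) (A : 'M[R[i]]_m) : R[i] := cexp (\tr A).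

(* Euler's integral, for Re z > 0 *)
Definition cgamma (R : realType) (z : R[i]) : R[i] :=
  let g (t : R) := rcpow t (z - 1) * (expR (- t))%:C in
  (\int[lebesgue_measure]_(t in `]0, +oo[) complex.Re (g t)) +i*
  (\int[lebesgue_measure]_(t in `]0, +oo[) complex.Im (g t)).

Definition mgamma (R : realType) (m : nat) (a : R[i]) : R[i] :=
  (pi `^ ((m * m.-1)%:R / 4))%:C * \prod_(i < m) cgamma (a - i%:R / 2).

Definition posdef (R : realType) (m : nat) (A : 'M[R]_m) : Prop :=
  A^T = A /\ forall x : 'cV[R]_m, x != 0 -> 0 < (x^T *m A *m x) ord0 ord0.

Definition toC (R : realType) (m : nat) (A : 'M[R]_m) : 'M[R[i]]_m :=
  map_mx (real_complex R) A.

Definition posre_sym (R : realType) (m : nat) (Z : 'M[R[i]]_m) : Prop :=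
  Z^T = Z /\ posdef (map_mx (@complex.Re R) Z).

(* The logarithm of the determinant that defines the powers |Z|^s: on the convex
   set of the complex symmetric matrices with positive definite real part there
   is exactly one continuous choice that makes |A|^s positive for real A, s. *)
Definition is_logdet (R : realType) (m : nat) (l : 'M[R[i]^o]_m -> R[i]^o) :
    Prop :=
  [/\ {within [set Z : 'M[R[i]^o]_m | posre_sym (Z : 'M[R[i]]_m)],
        continuous l},
      forall Z : 'M[R[i]]_m, posre_sym Z -> cexp (l Z) = \det Z
    & forall (A : 'M[R]_m) (s : R), posdef A -> 0 < cexp (s%:C * l (toC A))].

Definition logdet (R : realType) (m : nat) : 'M[R[i]]_m -> R[i] :=
  xget (fun=> 0) [set l | @is_logdet R m l].

Definition detpow (R : realType) (m : nat) (Z : 'M[R[i]]_m) (s : R[i]) : R[i] :=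
  cexp (s * logdet Z).

(* Positions of the functionally independent entries of a symmetric matrix. *)
Definition utri (m : nat) : Type := {p : 'I_m * 'I_m | (p.1 <= p.2)%N}.

Lemma utri_pair_subproof (m : nat) (i j : 'I_m) :
  let p := if (i <= j)%N then (i, j) else (j, i) in (p.1 <= p.2)%N.
Proof. by rewrite /=; case: (leqP i j) => // /ltnW. Qed.

Definition utri_pair (m : nat) (i j : 'I_m) : utri m :=
  exist (fun p : 'I_m * 'I_m => is_true (p.1 <= p.2)%N) _
    (utri_pair_subproof i j).

Definition symdim (m : nat) : nat := #|{: utri m}|.

Definition sym_coords (R : realType) (m : nat) (X : 'M[R]_m) :
    (symdim m).-tuple R :=
  [tuple X (val (enum_val k)).1 (val (enum_val k)).2 | k < symdim m].

Definition sym_mx (R : realType) (m : nat) (v : (symdim m).-tuple R) : 'M[R]_m :=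
  \matrix_(i, j) tnth v (enum_rank (utri_pair i j)).

Lemma sym_coordsK (R : realType) (m : nat) (X : 'M[R]_m) :
  X^T = X -> sym_mx (sym_coords X) = X.
Proof.
move=> XT; apply/matrixP => i j; rewrite mxE tnth_mktuple enum_rankK /=.
by case: leqP => _ //=; rewrite -[in LHS]XT mxE.
Qed.

Lemma sym_mxK (R : realType) (m : nat) (v : (symdim m).-tuple R) :
  sym_coords (sym_mx v) = v.
Proof.
apply: eq_from_tnth => k; rewrite tnth_mktuple mxE; congr (tnth v _).
rewrite -[RHS]enum_valK; congr enum_rank; apply: val_inj => /=.
by rewrite (valP (enum_val k)); case: (val (enum_val k)).
Qed.

Lemma symdimE (m : nat) : symdim m = 'C(m.+1, 2).
Proof.
rewrite /symdim card_sig -sum1_card.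
rewrite -(pair_big_dep xpredT (fun i j : 'I_m => (i <= j)%N) (fun _ _ => 1%N)) /=.
rewrite (exchange_big_dep xpredT) //= -bin2_sum big_mkord big_ord_recl /= add0n.
apply: eq_bigr => j _.
by rewrite -(big_ord_widen m (fun _ => 1%N) (ltn_ord j)) sum1_card card_ord.
Qed.

(* The product of n copies of Lebesgue measure on R. *)
Fixpoint lebesgue_tuple (R : realType) (n : nat) :
    set (n.-tuple R) -> \bar R :=
  match n return set (n.-tuple R) -> \bar R with
  | 0 => \d_ ([tuple] : 0.-tuple R)
  | n'.+1 => fun A =>
      product_measure1 lebesgue_measure (@lebesgue_tuple R n')
        [set p : R * n'.-tuple R | A [tuple of p.1 :: p.2]]
  end.

Definition posdef_coords (R : realType) (m : nat) : set ((symdim m).-tuple R) :=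
  [set v | posdef (sym_mx v)].

(* X is a random positive definite matrix with density f. The formulas for f are
   complex valued; 0 <= f S in R[i] means that f S is real and nonnegative. *)
Record has_density (d : measure_display) (T : measurableType d) (R : realType)
    (P : probability T R) (m : nat) (X : T -> 'M[R]_m) (f : 'M[R]_m -> R[i]) :
    Prop := HasDensity {
  density_random : forall i j, measurable_fun [set: T] (fun w => X w i j);
  density_posdef : {ae P, forall w, posdef (X w)};
  density_ge0 : forall S, posdef S -> 0 <= f S;
  density_measurable :
    measurable_fun (@posdef_coords R m) (fun v => complex.Re (f (sym_mx v)));
  density_law : forall B : set ((symdim m).-tuple R), measurable B ->
    P ((fun w => sym_coords (X w)) @^-1` B) =
    (\int[@lebesgue_tuple R (symdim m)]_(v in B `&` @posdef_coords R m)
       (complex.Re (f (sym_mx v)))%:E)%E }.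

Definition hypergeom_gamma_norm (R : realType) (m : nat) (aa bb : seq R[i])
    (a : R[i]) (Ups Xi : 'M[R[i]]_m) : R[i] :=
  detpow Xi a /
  (mgamma m a * hypergeom (rcons aa a) bb (Ups *m invmx Xi)).

Definition hypergeom_gamma_pdf (R : realType) (m : nat) (aa bb : seq R[i])
    (a : R[i]) (Ups Xi : 'M[R[i]]_m) (Y : 'M[R]_m) : R[i] :=
  hypergeom_gamma_norm aa bb a Ups Xi * etr (- (Xi *m toC Y)) *
  rcpow (\det Y) (a - m.+1%:R / 2) * hypergeom aa bb (Ups *m toC Y).

(* Main.v *)
Require Import Defs.
Set Warnings "-all".
From HB Require Import structures.
From mathcomp Require Import all_boot all_order all_algebra complex.
From mathcomp Require Import all_classical all_reals all_analysis.
From mathcomp Require Import measurable_realfun ring lra.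
Import Order.TTheory GRing.Theory Num.Theory.
Import numFieldNormedType.Exports.
Set Implicit Arguments.
Unset Strict Implicit.
Unset Printing Implicit Defensive.
Local Open Scope classical_set_scope.
Local Open Scope ring_scope.

(** Inversion S |-> S^-1 is an involution of the cone of positive definite
    matrices, so the law of Y^-1 gives to a set B the mass that the law of Y
    gives to the set of the inverses of the elements of B. The theorem
    therefore amounts to a change of variables: in the m(m+1)/2 free
    coordinates of a symmetric matrix, inversion has Jacobian |S|^-(m+1)
    ([ge0_integral_posdef_invmx]). The rest is the power identity
    |S^-1|^(a-(m+1)/2) |S|^-(m+1) = |S|^(-a-(m+1)/2) ([rcpow_inv]): it shows
    that the density f of Y satisfies f(S^-1) |S|^-(m+1) = g(S), where g is
    the density that is claimed for Y^-1.

    The Jacobian is computed without derivatives in several variables. The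
    sweep of a matrix A at k, also known as principal pivot transform,
    replaces the pivot p = a_kk by -1/p, the other entries of row and column k
    by a_ik/p, and every remaining entry by a_ij - a_ik a_kj/p. It exchanges
    the k-th input of the linear map A for its k-th output; once all k have
    been swept, the matrix is -A^-1 and the product of the m pivots is det A
    ([sweeps_all]). On symmetric matrices one sweep moves the free coordinates
    one after the other: the entries off row k are translated, the m-1 entries
    of row k outside the diagonal are divided by p, and p is sent to -1/p,
    which has derivative 1/p^2. Hence its Jacobian is |p|^-(m+1)
    ([transports_sweep]), and the Jacobians of the m sweeps multiply to |det
    A|^-(m+1).

    To move a single coordinate by a map of the line that depends on the other
    coordinates is allowed by Tonelli's theorem ([eq_integral_slices],
    [transports_coord]), provided that the effect on integrals is known for
    affine maps and for x |-> -1/x on the line; there Lebesgue measure is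
    determined by its values on intervals.

    All these changes of variables hold on the whole space of symmetric
    matrices: with the convention 0^-1 = 0 the Jacobian factor vanishes as
    soon as a pivot does, so that no singular set has to be removed. The cone
    comes in last: a symmetric matrix is positive definite exactly when all
    its pivots are positive ([posdefP]). This makes the cone measurable and
    keeps the pivots away from zero on it. *)

(** * Maps that transport a measure, up to a density factor *)

Section transport.
Local Open Scope ereal_scope.
Context d (X : measurableType d) (R : realType).
Implicit Types (T : X -> X) (J : X -> R) (mu : {measure set X -> \bar R}).

(** Change of variables by T with Jacobian J. Stating it for integrals over
    the whole space, and not for a bijection between two domains, lets J
    vanish where T is degenerate and makes the property stable under
    composition. *)
Record transports (mu : set X -> \bar R) T J : Prop := Transports {
  transports_measurable : measurable_fun [set: X] T;
  transports_jac_measurable : measurable_fun [set: X] J;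
  transports_jac_ge0 : forall x, (0 <= J x)%R;
  transportsE : forall h : X -> \bar R, measurable_fun [set: X] h ->
    (forall x, 0 <= h x) ->
    \int[mu]_x (h (T x) * (J x)%:E) = \int[mu]_x h x }.

(** The chain rule for Jacobians. *)
Lemma transports_comp (mu : set X -> \bar R) T1 J1 T2 J2 :
  transports mu T1 J1 -> transports mu T2 J2 ->
  transports mu (T2 \o T1) (fun x => J2 (T1 x) * J1 x)%R.
Proof.
move=> [mT1 mJ1 J1_ge0 E1] [mT2 mJ2 J2_ge0 E2]; split.
- exact: measurableT_comp.
- by apply: measurable_funM => //; exact: measurableT_comp.
- by move=> x; exact: mulr_ge0.
- move=> h mh h0.
  rewrite (_ : (fun x => _) =
      fun x => (h (T2 (T1 x)) * (J2 (T1 x))%:E) * (J1 x)%:E); last first.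
    by apply/funext => x /=; rewrite EFinM muleA.
  rewrite (E1 (fun y => h (T2 y) * (J2 y)%:E)) ?E2//.
  + apply: emeasurable_funM; first exact: measurableT_comp.
    exact/measurable_EFinP.
  + by move=> x; rewrite mule_ge0// lee_fin.
Qed.

Lemma transports_id mu : transports mu id (cst 1%R).
Proof.
by split => // h _ _; apply: eq_integral => x _; rewrite mule1.
Qed.

Import HBNNSimple.

(** Both sides of the change of variables are linear and monotone continuous in
    h, so indicator functions suffice. *)
Lemma transports_sets mu T J :
  measurable_fun [set: X] T -> measurable_fun [set: X] J ->
  (forall x, 0 <= J x)%R ->
  (forall A, measurable A -> \int[mu]_x (\1_A (T x) * J x)%:E = mu A) ->
  transports mu T J.
Proof.
move=> mT mJ J0 TJ; split => // h mh h0.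
pose g := nnsfun_approx measurableT mh.
have gE x : h x = limn (EFin \o g ^~ x).
  by apply/esym/cvg_lim => //; exact: cvg_nnsfun_approx.
have ndg x : nondecreasing_seq (EFin \o g ^~ x).
  by move=> a b ab; rewrite lee_fin; exact/lefP/nd_nnsfun_approx.
have mgT n : measurable_fun [set: X] (fun x => g n (T x)).
  by apply: (measurableT_comp _ mT).
transitivity (limn (fun n => \int[mu]_x ((g n (T x) * J x)%:E))).
  rewrite -monotone_convergence//.
  - apply: eq_integral => x _; apply/esym/cvg_lim => //=.
    rewrite (_ : (fun _ => _) = fun n => ((EFin \o g ^~ (T x)) n * (J x)%:E)).
      apply: cvgeZr => //; rewrite gE; apply: ereal_nondecreasing_is_cvgn.
      exact: ndg.
    by apply/funext => n; rewrite /= EFinM.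
  - by move=> n; apply/measurable_EFinP/measurable_funM.
  - by move=> n x _; rewrite lee_fin mulr_ge0.
  - move=> x _ a b ab; rewrite lee_fin ler_wpM2r//.
    by have := ndg (T x) _ _ ab; rewrite lee_fin.
transitivity (limn (fun n => \int[mu]_x ((g n x)%:E))); last first.
  rewrite -monotone_convergence//.
  - by apply: eq_integral => x _; rewrite gE.
  - by move=> n; apply/measurable_EFinP.
  - by move=> n x _; rewrite lee_fin.
  - by move=> x _; exact: ndg.
apply: congr_lim; apply/funext => n.
under eq_integral.
  move=> x _; rewrite fimfunE mulr_fsuml.
  under eq_fsbigr do rewrite -mulrA.
  rewrite -fsumEFin//.
  over.
under [RHS]eq_integral do rewrite fimfunE -fsumEFin//.
rewrite !ge0_integral_fsum//; first last.
- move=> y x _; rewrite mulrA EFinM; apply: mule_ge0; last by rewrite lee_fin.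
  exact: nnfun_muleindic_ge0.
- move=> y; apply/measurable_EFinP; apply: measurable_funM => //.
  apply: measurable_funM => //; apply: (measurableT_comp _ mT).
  exact: measurable_indic.
- by move=> y x _; exact: nnfun_muleindic_ge0.
- by move=> y; apply/measurable_EFinP; apply: measurable_funM.
apply: eq_fsbigr => y; rewrite inE => -[x _ gxy].
have y0 : (0 <= y)%R by rewrite -gxy.
under eq_integral do rewrite EFinM.
under [RHS]eq_integral do rewrite EFinM.
have mA : measurable (g n @^-1` [set y]) by [].
rewrite !ge0_integralZl_EFin//.
- by rewrite TJ// integral_indic// setIT.
- by apply/measurable_EFinP; exact: measurable_indic.
- by move=> ? _; rewrite lee_fin mulr_ge0.
- apply/measurable_EFinP/measurable_funM => //.
  by apply: (measurableT_comp _ mT); exact: measurable_indic.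
Qed.

End transport.

(** * Affine maps and inversion on the real line *)

Section line.
Local Open Scope ereal_scope.
Context (R : realType).
Notation mu := (@lebesgue_measure R).
Implicit Types (T : measurableTypeR R -> measurableTypeR R)
  (J : measurableTypeR R -> R).

(** The measure that gives to A the integral of J over the preimage of A agrees
    with Lebesgue measure on intervals, hence everywhere. *)
Lemma transports_lebesgue T J :
  measurable_fun [set: measurableTypeR R] T ->
  measurable_fun [set: measurableTypeR R] J ->
  (forall x, 0 <= J x)%R ->
  (forall a b : R, (a < b)%R ->
     \int[mu]_x (\1_`]a, b] (T x) * J x)%:E = (b - a)%:E) ->
  transports mu T J.
Proof.
move=> mT mJ J0 TJ; apply: transports_sets => //.
pose nu (A : set (measurableTypeR R)) := \int[mu]_x (\1_A (T x) * J x)%:E.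
have mF (A : set (measurableTypeR R)) : measurable A ->
    measurable_fun [set: measurableTypeR R] (fun x => (\1_A (T x) * J x)%:E).
  move=> mA; apply/measurable_EFinP/measurable_funM => //.
  by apply: (measurableT_comp _ mT); exact: measurable_indic.
have nu0 : nu set0 = 0.
  by rewrite /nu integral0_eq// => x _; rewrite indic0 mul0r.
have nu_ge0 A : 0 <= nu A.
  by apply: integral_ge0 => x _; rewrite lee_fin mulr_ge0.
have nu_add : semi_sigma_additive nu.
  move=> F mF' tF mUF; rewrite [X in _ --> X](_ : _ = \sum_(n <oo) nu (F n)).
    apply/cvg_closeP; split; [exact: is_cvg_nneseries|by rewrite closeE].
  rewrite -integral_nneseries//.
  - apply: eq_integral => x _.
    under eq_eseriesr do rewrite mulrC EFinM.
    by rewrite nneseriesZl// -indic_bigcup// mulrC EFinM.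
  - by move=> n; exact: mF.
  - by move=> n x _; rewrite lee_fin mulr_ge0.
pose nuM : {measure set (measurableTypeR R) -> \bar R} :=
  HB.pack nu (isMeasure.Build _ _ _ nu nu0 nu_ge0 nu_add).
move=> A mA; apply/esym/(lebesgue_measure_unique (mu := nuM)) => //.
move=> _ [[a b] _ <-] /=; rewrite lebesgue_measure_itv /=.
rewrite lte_fin; case: ltP => [ab|ba].
  by rewrite /nu TJ.
by rewrite set_itv_ge ?nu0// bnd_simp -leNgt.
Qed.

Lemma measurable_inv : measurable_fun [set: R] (@GRing.inv R).
Proof.
have -> : [set: R] = [set 0%R] `|` [set x | x != 0%R].
  by apply/seteqP; split => // x _; have [->|] := eqVneq x 0%R; [left|right].
have oR : open [set x : R | x != 0%R] by exact: open_neq.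
apply/measurable_funU => //; first exact: open_measurable.
split; first exact: measurable_fun_set1.
apply: open_continuous_measurable_fun => // x; rewrite inE.
exact: inv_continuous.
Qed.

Lemma transports_affine (alpha beta : R) : alpha != 0%R ->
  transports mu (fun x => alpha * x + beta)%R (cst `|alpha|%R).
Proof.
move=> a0.
have mT : measurable_fun [set: measurableTypeR R]
    (fun x => alpha * x + beta : measurableTypeR R)%R.
  by apply: measurable_funD => //; exact: measurable_funM.
apply: transports_lebesgue => // a b ab.
under eq_integral do rewrite mulrC EFinM.
rewrite ge0_integralZl_EFin//; first last.
- apply/measurable_EFinP; apply: (measurableT_comp _ mT).
  exact: measurable_indic.
have [alt0|agt0|/eqP] := ltgtP alpha 0%R; last by rewrite (negbTE a0).
- rewrite (_ : (fun x => _) =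
      fun x : measurableTypeR R =>
        (\1_(`[((b - beta) / alpha)%R, ((a - beta) / alpha)%R[) x)%:E);
    last first.
    apply/funext => x; rewrite !indicE; congr (_%:R%:E); congr nat_of_bool.
    apply/idP/idP; rewrite !inE /= !in_itv /= ler_ndivrMr// ltr_ndivlMr//.
      by move=> /andP[]; lra.
    by move=> /andP[? ?]; apply/andP; split; lra.
  rewrite integral_indic//= setIT lebesgue_measure_itv/= lte_fin.
  rewrite ltr_nM2r ?invr_lt0// ltrD2r ab -EFinD -EFinM; congr EFin.
  by rewrite ltr0_norm//; field.
- rewrite (_ : (fun x => _) =
      fun x : measurableTypeR R =>
        (\1_(`]((a - beta) / alpha)%R, ((b - beta) / alpha)%R]) x)%:E);
    last first.
    apply/funext => x; rewrite !indicE; congr (_%:R%:E); congr nat_of_bool.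
    apply/idP/idP; rewrite !inE /= !in_itv /= ltr_pdivrMr// ler_pdivlMr//.
      by move=> /andP[? ?]; apply/andP; split; lra.
    by move=> /andP[? ?]; apply/andP; split; lra.
  rewrite integral_indic//= setIT lebesgue_measure_itv/= lte_fin.
  rewrite ltr_pM2r ?invr_gt0// ltrD2r ab -EFinD -EFinM; congr EFin.
  by rewrite gtr0_norm//; field.
Qed.

Lemma integral_inv_sqr_tail (c : R) : (0 < c)%R ->
  \int[mu]_(x in `[c, +oo[) ((x^-1 ^+ 2)%R)%:E = (c^-1)%:E.
Proof.
move=> c0.
have n0 (x : R) : (c <= x -> x != 0)%R.
  by move=> cx; rewrite gt_eqF// (lt_le_trans c0).
have cV (x : R) : (c <= x)%R -> (y^-1)%R @[y --> x] --> (x^-1)%R.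
  by move=> /n0 cx; exact: inv_continuous.
have cV2 (x : R) : (c <= x)%R -> (y^-1 ^+ 2)%R @[y --> x] --> (x^-1 ^+ 2)%R.
  by move=> cx; rewrite expr2; apply: cvgM; exact: cV.
rewrite (@ge0_continuous_FTC2y _ _ (fun x => - x^-1)%R c 0%R).
- by rewrite sub0e EFinN oppeK.
- by move=> x _; exact: sqr_ge0.
- apply/continuous_within_itvcyP; split.
    by move=> x; rewrite in_itv /= andbT => /ltW /cV2.
  by apply: cvg_at_right_filter; exact: cV2.
- rewrite -oppr0; apply: cvgN; apply/gtr0_cvgV0.
    by exists 0%R; split => // x x0; rewrite invr_gt0.
  exact: cvg_id.
- move=> x cx; apply: derivableN; apply: derivableV => //.
  by rewrite n0// ltW.
- by apply: cvgN; apply: cvg_at_right_filter; exact: cV.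
- move=> x; rewrite in_itv /= andbT => cx.
  rewrite derive1E deriveN; last by apply: derivableV => //; rewrite n0// ltW.
  rewrite deriveV//; last by rewrite n0// ltW.
  by rewrite derive_id scaleNr opprK -exprVn; exact: mulr1.
Qed.

(** The map x |-> -1/x exchanges the bounded intervals that end at 0 with the
    half-lines that avoid 0, over which 1/x^2 has an explicit integral.
    Additivity then gives all other intervals. The value -1/0 = 0 is harmless
    since the factor 1/x^2 is then 0 as well. *)
Lemma transports_inv : transports mu (fun x => - x^-1)%R (fun x => x^-1 ^+ 2)%R.
Proof.
have mV : measurable_fun [set: measurableTypeR R]
    (fun x => x^-1 : measurableTypeR R)%R by exact: measurable_inv.
have mT : measurable_fun [set: measurableTypeR R]
    (fun x => - x^-1 : measurableTypeR R)%R.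
  exact: measurableT_comp.
have mJ : measurable_fun [set: measurableTypeR R] (fun x => x^-1 ^+ 2)%R.
  exact: measurable_funX.
have tail closed (c : R) : (0 < c)%R ->
    \int[mu]_x (\1_[set` Interval (BSide closed c^-1%R) (BInfty _ false)] x
                * x^-1 ^+ 2)%:E = c%:E.
  move=> c0; transitivity (\int[mu]_(x in
      [set` Interval (BSide closed c^-1%R) (BInfty _ false)]) (x^-1 ^+ 2)%:E).
    rewrite [RHS]integral_mkcond; apply: eq_integral => x _.
    by rewrite patchE indicE; case: (x \in _); rewrite ?mul1r ?mul0r.
  rewrite -[in RHS](invrK c) -integral_inv_sqr_tail ?invr_gt0//.
  case: closed => //; apply: integral_itv_obnd_cbnd.
  exact/measurable_EFinP/measurable_funTS.
pose nu (a b : R) := \int[mu]_x (\1_(`]a, b]) (- x^-1) * x^-1 ^+ 2)%:E.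
have mnu (A : set (measurableTypeR R)) : measurable A ->
    measurable_fun [set: measurableTypeR R]
      (fun x => (\1_A (- x^-1) * x^-1 ^+ 2)%:E)%R.
  move=> mA; apply/measurable_EFinP/measurable_funM => //.
  by apply: (measurableT_comp _ mT); exact: measurable_indic.
have nuU (a b c : R) : (a <= b)%R -> (b <= c)%R ->
    nu a c = nu a b + nu b c.
  move=> ab bc; rewrite /nu -ge0_integralD//.
  - apply: eq_integral => x _; rewrite -EFinD -mulrDl; congr (_ * _)%:E.
    rewrite !indicE -natrD; congr _%:R.
    rewrite !mem_setE !in_itv/=; have [yb|yb] := leP (- x^-1)%R b.
      by rewrite (le_trans yb bc) !andbT addn0.
    by rewrite (le_lt_trans ab yb) andbF add0n.
  - by move=> x _; rewrite lee_fin mulr_ge0// sqr_ge0.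
  - exact: mnu.
  - by move=> x _; rewrite lee_fin mulr_ge0// sqr_ge0.
  - exact: mnu.
(* The half-line is on the negative side: reflect it. *)
have nupos (c : R) : (0 <= c)%R -> nu 0%R c = c%:E.
  rewrite le_eqVlt => /predU1P[<-|c0].
    rewrite /nu integral0_eq// => x _.
    by rewrite set_itv_ge ?indic0 ?mul0r// bnd_simp ltxx.
  rewrite -(tail true c c0) /nu.
  have N1 : (-1 : R)%R != 0%R by rewrite oppr_eq0 oner_eq0.
  have [_ _ _ refl] := transports_affine 0 N1.
  rewrite -(refl (fun x => (\1_`[c^-1, +oo[ x * x^-1 ^+ 2)%:E)); first last.
  - by move=> x; rewrite lee_fin mulr_ge0// sqr_ge0.
  - by apply/measurable_EFinP/measurable_funM => //; exact: measurable_indic.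
  apply: eq_integral => x _; rewrite /= normrN1 mule1 addr0 mulN1r invrN sqrrN.
  congr (_ * _)%:E; rewrite !indicE !mem_setE !in_itv/= andbT; congr (_ _)%:R.
  rewrite -invrN invr_gt0; case: (ltP 0%R (- x)%R) => xn /=.
    by rewrite invf_ple.
  by apply/esym/negbTE; rewrite -ltNge (le_lt_trans xn)// invr_gt0.
have nuneg (c : R) : (0 <= c)%R -> nu (- c)%R 0%R = c%:E.
  rewrite le_eqVlt => /predU1P[<-|c0].
    rewrite /nu integral0_eq// => x _.
    by rewrite set_itv_ge ?indic0 ?mul0r// bnd_simp oppr0 ltxx.
  rewrite -(tail false c c0) /nu; apply: eq_integral => x _.
  have [->|x0] := eqVneq x 0%R; first by rewrite invr0 expr0n/= !mulr0.
  congr (_ * _)%:E; rewrite !indicE !mem_setE !in_itv/= andbT; congr (_ _)%:R.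
  rewrite ltrN2 oppr_le0 invr_ge0 andbC.
  move: x0; case: (ltgtP x 0%R) => //= xn _; last by rewrite invf_plt.
  by apply/esym/negbTE; rewrite -leNgt (le_trans (ltW xn))// invr_ge0 ltW.
apply: transports_lebesgue => //.
  by move=> x; exact: sqr_ge0.
move=> a b ab; rewrite -/(nu _ _).
have [a0|a0] := leP 0%R a.
  have := nuU _ _ _ a0 (ltW ab).
  rewrite !nupos//; last exact: le_trans (ltW ab).
  by case: (nu _ _) => // r [->]; rewrite addrAC subrr add0r.
have [b0|b0] := leP b 0%R.
  have := nuneg (- b)%R; rewrite oppr_ge0 opprK => /(_ b0) nub.
  have := nuneg (- a)%R; rewrite oppr_ge0 opprK => /(_ (ltW a0)).
  rewrite (nuU _ _ _ (ltW ab) b0) nub.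
  by case: (nu _ _) => // r [/eqP]; rewrite subr_eq => /eqP ->; rewrite addrC.
have := nuneg (- a)%R; rewrite oppr_ge0 opprK => /(_ (ltW a0)) nua.
by rewrite (nuU _ 0%R) ?ltW// nupos ?ltW// nua -EFinD addrC.
Qed.

End line.

(** * Lebesgue measure on tuples, one coordinate at a time *)

Section tuple_measure.
Context (R : realType).
Local Open Scope ereal_scope.

Definition cons_pair n (p : measurableTypeR R * n.-tuple R) : n.+1.-tuple R :=
  [tuple of p.1 :: p.2].

Definition uncons_pair n (v : n.+1.-tuple R) : measurableTypeR R * n.-tuple R :=
  (thead v, [tuple of behead v]).

Lemma cons_pairK n : cancel (@cons_pair n) (@uncons_pair n).
Proof.
move=> [x v]; rewrite /uncons_pair /cons_pair; congr (_, _).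
by apply: val_inj.
Qed.

Lemma measurable_cons_pair n : measurable_fun [set: _] (@cons_pair n).
Proof.
by apply: measurable_cons; [exact: measurable_fst|exact: measurable_snd].
Qed.

Lemma measurable_uncons_pair n : measurable_fun [set: _] (@uncons_pair n).
Proof.
apply: measurable_fun_pair; last exact: measurable_behead.
exact: measurable_tnth.
Qed.

Lemma lebesgue_tupleS n (A : set (n.+1.-tuple R)) :
  lebesgue_tuple A =
  (lebesgue_measure \x (@lebesgue_tuple R n)) (@cons_pair n @^-1` A).
Proof. by []. Qed.

(** Sigma-finiteness is carried along the recursion because the product with
    Lebesgue measure is known to be a measure only when its second factor is
    sigma-finite. *)
Lemma lebesgue_tuple_measure n :
  exists mu : {sigma_finite_measure set (n.-tuple R) -> \bar R},
    @lebesgue_tuple R n = mu :> (set (n.-tuple R) -> \bar R).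
Proof.
elim: n => [|n [mu IH]].
  by exists (\d_([tuple] : 0.-tuple R)).
pose pi : {measure set (measurableTypeR R * n.-tuple R)%type -> \bar R} :=
  lebesgue_measure \x mu.
pose nu : {measure set (n.+1.-tuple R) -> \bar R} :=
  measure_function_pushforward__canonical__measure_function_Measure pi
    (@measurable_cons_pair n).
have nu_fin : sigma_finite [set: n.+1.-tuple R] nu.
  have /sigma_finiteP[F [TF ndF Foo]] :=
    sigma_finiteT (@lebesgue_measure R).
  have /sigma_finiteP[G [TG ndG Goo]] := sigma_finiteT mu.
  exists (fun k => @uncons_pair n @^-1` (F k `*` G k)).
    apply/seteqP; split => // v _.
    have [i _ Fi] : (\bigcup_i F i) (uncons_pair v).1 by rewrite -TF.
    have [j _ Gj] : (\bigcup_i G i) (uncons_pair v).2 by rewrite -TG.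
    exists (maxn i j) => //; split.
      by move: Fi; exact/subsetPset/ndF/leq_maxl.
    by move: Gj; exact/subsetPset/ndG/leq_maxr.
  move=> k; have [mF Fk] := Foo k; have [mG Gk] := Goo k; split.
    rewrite -[X in measurable X]setTI; apply: measurable_uncons_pair => //.
    exact: measurableX.
  rewrite /nu /= /pushforward -comp_preimage.
  rewrite (_ : _ \o _ = id) ?preimage_id; last first.
    by apply/funext => p /=; rewrite cons_pairK.
  by rewrite [ltLHS]product_measure1E// lte_mul_pinfty// ge0_fin_numE.
pose nus : {sigma_finite_measure set (n.+1.-tuple R) -> \bar R} :=
  HB.pack (Measure.sort nu) (Measure_isSigmaFinite.Build _ _ _ nu nu_fin).
exists nus.
by apply/funext => A; rewrite lebesgue_tupleS IH.
Qed.

Section instances.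
Variable n : nat.

Let lebesgue_tuple0 : @lebesgue_tuple R n set0 = 0.
Proof. by have [mu ->] := lebesgue_tuple_measure n; rewrite measure0. Qed.

Let lebesgue_tuple_ge0 A : 0 <= @lebesgue_tuple R n A.
Proof. by have [mu ->] := lebesgue_tuple_measure n. Qed.

Let lebesgue_tuple_sigma_additive : semi_sigma_additive (@lebesgue_tuple R n).
Proof.
have [mu ->] := lebesgue_tuple_measure n.
exact: measure_semi_sigma_additive.
Qed.

HB.instance Definition _ := isMeasure.Build _ _ _ (@lebesgue_tuple R n)
  lebesgue_tuple0 lebesgue_tuple_ge0 lebesgue_tuple_sigma_additive.

Let lebesgue_tuple_sigma_finite :
  sigma_finite [set: n.-tuple R] (@lebesgue_tuple R n).
Proof.
by have [mu ->] := lebesgue_tuple_measure n; exact: sigma_finiteT.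
Qed.

HB.instance Definition _ := Measure_isSigmaFinite.Build _ _ _
  (@lebesgue_tuple R n) lebesgue_tuple_sigma_finite.

End instances.

Lemma ge0_integral_lebesgue_tupleS n (f : n.+1.-tuple R -> \bar R) :
  measurable_fun [set: _] f -> (forall v, 0 <= f v) ->
  \int[@lebesgue_tuple R n.+1]_v f v =
  \int[lebesgue_measure]_x \int[@lebesgue_tuple R n]_v f (cons_pair (x, v)).
Proof.
move=> mf f0.
have -> : @lebesgue_tuple R n.+1 =
    pushforward (lebesgue_measure \x @lebesgue_tuple R n) (@cons_pair n).
  by apply/funext => A; rewrite lebesgue_tupleS.
rewrite ge0_integral_pushforward//; last exact: measurable_cons_pair.
rewrite preimage_setT fubini_tonelli1//.
  by apply: measurableT_comp => //; exact: measurable_cons_pair.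
by move=> p; exact: f0.
Qed.

Lemma ge0_integral_lebesgue_tupleS_swap n (f : n.+1.-tuple R -> \bar R) :
  measurable_fun [set: _] f -> (forall v, 0 <= f v) ->
  \int[@lebesgue_tuple R n.+1]_v f v =
  \int[@lebesgue_tuple R n]_v \int[lebesgue_measure]_x f (cons_pair (x, v)).
Proof.
move=> mf f0; rewrite ge0_integral_lebesgue_tupleS//.
apply: (fubini_tonelli (fun p => f (cons_pair p))) => //.
by apply: measurableT_comp => //; exact: measurable_cons_pair.
Qed.

Definition upd n (v : n.-tuple R) (k : 'I_n) (s : R) : n.-tuple R :=
  [tuple if c == k then s else tnth v c | c < n].

(** Tonelli's theorem for the coordinate k. As each line parallel to the k-th
    axis is given by any of its points v, the tuple need not be split at an
    arbitrary position; the order of integration is exchanged only when k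
    reaches the head. *)
Lemma eq_integral_slices n (k : 'I_n) (F G : n.-tuple R -> \bar R) :
  measurable_fun [set: _] F -> (forall v, 0 <= F v) ->
  measurable_fun [set: _] G -> (forall v, 0 <= G v) ->
  (forall v, \int[lebesgue_measure]_s F (upd v k s) =
             \int[lebesgue_measure]_s G (upd v k s)) ->
  \int[@lebesgue_tuple R n]_v F v = \int[@lebesgue_tuple R n]_v G v.
Proof.
elim: n => [|n IH] in k F G *; first by case: k.
move=> mF F0 mG G0; have [j ->|->] := unliftP ord0 k => FG; last first.
  rewrite (ge0_integral_lebesgue_tupleS_swap mF F0).
  rewrite (ge0_integral_lebesgue_tupleS_swap mG G0).
  apply: eq_integral => v _; have := FG (cons_pair (0%R, v)).
  rewrite (_ : upd _ _ = fun s => cons_pair (s, v))//.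
  apply/funext => s; apply: eq_from_tnth => i; rewrite tnth_mktuple.
  by have [l ->|->] := unliftP ord0 i; rewrite ?eqxx ?tnthS.
rewrite (ge0_integral_lebesgue_tupleS mF F0).
rewrite (ge0_integral_lebesgue_tupleS mG G0).
have mcons (x : R) :
    measurable_fun [set: n.-tuple R] (fun v => cons_pair (x, v)).
  apply: measurableT_comp; first exact: measurable_cons_pair.
  exact: measurable_pair1.
apply: eq_integral => x _; apply: (IH j) => //.
- by apply: measurableT_comp => //; exact: mcons.
- by apply: measurableT_comp => //; exact: mcons.
- move=> v; have := FG (cons_pair (x, v)).
  rewrite (_ : upd _ _ = fun s => cons_pair (x, upd v j s))//.
  apply/funext => s; apply: eq_from_tnth => i; rewrite tnth_mktuple.
  have [l ->|->] := unliftP ord0 i; last by [].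
  by rewrite !tnthS tnth_mktuple (inj_eq lift_inj).
Qed.

End tuple_measure.

Section tuple_transport.
Context (R : realType).
Local Open Scope ereal_scope.
Notation mu := (@lebesgue_measure R).

(** A map of the line that varies measurably with the other coordinates may be
    applied to the coordinate k: on each line parallel to the k-th axis the
    one-dimensional formula holds with fixed tau and j. *)
Lemma transports_coord n (k : 'I_n) (tau : n.-tuple R -> R -> R)
    (j : n.-tuple R -> R -> R) :
  measurable_fun [set: n.-tuple R] (fun v => tau v (tnth v k)) ->
  measurable_fun [set: n.-tuple R] (fun v => j v (tnth v k)) ->
  (forall v s, tau (upd v k s) = tau v) ->
  (forall v s, j (upd v k s) = j v) ->
  (forall v,
     transports mu (tau v : measurableTypeR R -> measurableTypeR R) (j v)) ->
  transports (@lebesgue_tuple R n) (fun v => upd v k (tau v (tnth v k)))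
    (fun v => j v (tnth v k)).
Proof.
move=> mtau mj tauE jE tauT.
have mT :
    measurable_fun [set: n.-tuple R] (fun v => upd v k (tau v (tnth v k))).
  apply/measurable_fun_tnthP => c.
  rewrite (_ : _ \o _ = fun v => if c == k then tau v (tnth v k) else tnth v c).
    by case: eqP => // _; exact: measurable_tnth.
  by apply/funext => v /=; rewrite tnth_mktuple.
split => //.
- by move=> v; have [_ _ + _] := tauT v; exact.
- move=> h mh h0; apply: (eq_integral_slices (k := k)) => //.
  + apply: emeasurable_funM; first exact: measurableT_comp.
    exact/measurable_EFinP.
  + by move=> v; rewrite mule_ge0// lee_fin; have [_ _ + _] := tauT v; exact.
  + move=> v; have [_ _ _ /(_ (fun s => h (upd v k s)))] := tauT v.
    move=> <-//; last first.
      apply: measurableT_comp => //; apply/measurable_fun_tnthP => c.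
      rewrite (_ : _ \o _ = fun s => if c == k then s else tnth v c).
        by case: eqP.
      by apply/funext => s /=; rewrite tnth_mktuple.
    apply: eq_integral => s _; rewrite tauE jE tnth_mktuple eqxx.
    congr (h _ * _); apply: eq_from_tnth => c; rewrite !tnth_mktuple.
    by case: eqP.
Qed.

Definition affine_on n (s : seq 'I_n) (alpha beta : 'I_n -> n.-tuple R -> R)
    (v : n.-tuple R) : n.-tuple R :=
  [tuple if c \in s then (alpha c v * tnth v c + beta c v)%R else tnth v c
  | c < n].

(** The coefficients depend only on coordinates outside s, so changing the
    coordinates of s together is the same as changing them one by one. *)
Lemma transports_affine_on n (s : seq 'I_n)
    (alpha beta : 'I_n -> n.-tuple R -> R) :
  uniq s ->
  (forall c, measurable_fun [set: n.-tuple R] (alpha c)) ->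
  (forall c, measurable_fun [set: n.-tuple R] (beta c)) ->
  (forall c v, alpha c v != 0%R) ->
  (forall c v w, c \in s -> (forall i, i \notin s -> tnth v i = tnth w i) ->
    alpha c v = alpha c w /\ beta c v = beta c w) ->
  transports (@lebesgue_tuple R n) (affine_on s alpha beta)
    (fun v => \prod_(c <- s) `|alpha c v|)%R.
Proof.
move=> + malpha mbeta alpha0.
elim: s => [|k s IH] /=.
  move=> _ _; rewrite (_ : affine_on _ _ _ = id); last first.
    by apply/funext => v; apply: eq_from_tnth => c; rewrite tnth_mktuple.
  rewrite (_ : (fun _ => _) = cst 1%R); last first.
    by apply/funext => v; rewrite big_nil.
  exact: transports_id.
move=> /andP[ks us] dep.
have Ts : transports (@lebesgue_tuple R n) (affine_on s alpha beta)
    (fun v => \prod_(c <- s) `|alpha c v|)%R.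
  apply: (IH us) => c v w cs vw; apply: dep; first by rewrite inE cs orbT.
  by move=> i; rewrite inE negb_or => /andP[_]; exact: vw.
have updk v r :
    alpha k (upd v k r) = alpha k v /\ beta k (upd v k r) = beta k v.
  apply: dep; first exact: mem_head.
  move=> i; rewrite inE negb_or => /andP[/negbTE ik _].
  by rewrite tnth_mktuple ik.
have Tk := @transports_coord n k (fun v x => alpha k v * x + beta k v)%R
  (fun v => cst `|alpha k v|%R).
have {}Tk : transports (@lebesgue_tuple R n)
    (fun v => upd v k (alpha k v * tnth v k + beta k v)%R)
    (fun v => `|alpha k v|%R).
  apply: Tk.
  - apply: measurable_funD => //; apply: measurable_funM => //.
    exact: measurable_tnth.
  - by apply: measurableT_comp => //; exact: normr_measurable.
  - by move=> v r; have [-> ->] := updk v r.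
  - by move=> v r; have [-> _] := updk v r.
  - by move=> v; exact: transports_affine.
have aff v : alpha k (affine_on s alpha beta v) = alpha k v /\
    beta k (affine_on s alpha beta v) = beta k v.
  apply: dep; first exact: mem_head.
  by move=> i; rewrite inE negb_or tnth_mktuple => /andP[_ /negbTE->].
have := transports_comp Ts Tk; congr (transports _ _ _).
  apply/funext => v /=; apply: eq_from_tnth => c; rewrite !tnth_mktuple inE.
  have [-> ->] := aff v.
  by have [->|ck] := eqVneq c k; rewrite ?(negbTE ks).
by apply/funext => v; have [-> _] := aff v; rewrite big_cons.
Qed.

End tuple_transport.

(** * Sweeping a matrix *)

Section sweep.
Context (F : fieldType) (m : nat).
Implicit Types (A B : 'M[F]_m) (k : 'I_m) (K : {set 'I_m}).

(** The value at 0 is nonzero so that scaling a row by [sweep_inv p] is a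
    change of variables whatever the pivot p. *)
Definition sweep_inv (x : F) : F := if x == 0 then 1 else x^-1.

Lemma sweep_inv_neq0 x : sweep_inv x != 0.
Proof.
by rewrite /sweep_inv; have [x0|x0] := eqVneq x 0; rewrite ?oner_neq0 ?invr_eq0.
Qed.

Definition sweep k A : 'M[F]_m :=
  \matrix_(i, j)
    if i == k then (if j == k then - (A k k)^-1 else sweep_inv (A k k) * A i j)
    else (if j == k then sweep_inv (A k k) * A i j
          else A i j - A i k * A k j * (A k k)^-1).

Fixpoint sweeps (ks : seq 'I_m) A : 'M[F]_m :=
  if ks is k :: ks' then sweeps ks' (sweep k A) else A.

Fixpoint pivots (ks : seq 'I_m) A : seq F :=
  if ks is k :: ks' then A k k :: pivots ks' (sweep k A) else [::].

(** For y = A x, the matrices [exch_in A K] and [exch_out A K] send x to the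
    two vectors that arise from x and y when their coordinates in K are
    exchanged, with a sign: the first has entries y_i for i in K and x_i
    elsewhere, the second -x_i for i in K and y_i elsewhere. The matrix A
    swept at all k in K is the one that sends the first to the second. *)
Definition exch_in A K : 'M[F]_m :=
  \matrix_(i, j) if i \in K then A i j else (i == j)%:R.

Definition exch_out A K : 'M[F]_m :=
  \matrix_(i, j) if i \in K then - (i == j)%:R else A i j.

Lemma sweepE k A i j : sweep k A i j =
  if i == k then (if j == k then - (A k k)^-1 else sweep_inv (A k k) * A i j)
  else (if j == k then sweep_inv (A k k) * A i j
        else A i j - A i k * A k j * (A k k)^-1).
Proof. by rewrite mxE. Qed.

Lemma exch_inE A K i j :
  exch_in A K i j = if i \in K then A i j else (i == j)%:R.
Proof. by rewrite mxE. Qed.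

Lemma exch_outE A K i j :
  exch_out A K i j = if i \in K then - (i == j)%:R else A i j.
Proof. by rewrite mxE. Qed.

Lemma sweep_sym k A : A^T = A -> (sweep k A)^T = sweep k A.
Proof.
move=> AT; have AE i j : A i j = A j i by rewrite -[in LHS]AT mxE.
apply/matrixP => i j; rewrite !mxE.
have [ik|ik] := eqVneq i k; have [jk|jk] := eqVneq j k => //.
- by rewrite AE.
- by rewrite AE.
- by rewrite AE (AE j k) (AE k i) (mulrC (A k j)).
Qed.

(** The equation of row k can be solved for the input k because the pivot is
    nonzero; the solution is substituted in the other rows. *)
Lemma sweep_exch A K B k : k \notin K -> B k k != 0 ->
  B *m exch_in A K = exch_out A K ->
  sweep k B *m exch_in A (k |: K) = exch_out A (k |: K).
Proof.
move=> kK p0 BE; set p := B k k.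
have BEl i l : B i k * (k == l)%:R +
    \sum_(j | j != k) B i j * exch_in A K j l = exch_out A K i l.
  by rewrite -BE mxE [RHS](bigD1 k)//= (exch_inE A K k l) (negbTE kK).
have inE j l : j != k -> exch_in A (k |: K) j l = exch_in A K j l.
  by move=> jk; rewrite !mxE in_setU1 (negbTE jk).
have spE : sweep_inv p = p^-1 by rewrite /sweep_inv (negbTE p0).
have rowk l : \sum_(j | j != k) B k j * exch_in A K j l =
    A k l - p * (k == l)%:R.
  have := BEl k l; rewrite exch_outE (negbTE kK) => <-.
  by rewrite addrAC subrr add0r.
apply/matrixP => i l; rewrite mxE (bigD1 k)//= (exch_inE _ _ k) setU11.
have [->|ik] := eqVneq i k.
  rewrite exch_outE setU11 sweepE !eqxx.
  rewrite (eq_bigr (fun j => p^-1 * (B k j * exch_in A K j l))); last first.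
    by move=> j jk; rewrite inE// sweepE eqxx (negbTE jk) -/p spE mulrA.
  by rewrite -mulr_sumr rowk -/p; field.
rewrite sweepE (negbTE ik) eqxx -/p spE.
rewrite (eq_bigr (fun j => B i j * exch_in A K j l -
    p^-1 * B i k * (B k j * exch_in A K j l))); last first.
  move=> j jk; rewrite inE// sweepE (negbTE ik) (negbTE jk) -/p.
  by rewrite mulrBl; congr (_ - _); rewrite !mulrA; ring.
rewrite sumrB -mulr_sumr rowk.
have -> : exch_out A (k |: K) i l = exch_out A K i l.
  by rewrite !mxE in_setU1 (negbTE ik).
by rewrite -BEl; field.
Qed.

(** Exchanging k multiplies the input matrix on the left by the identity with
    row k replaced by row k of B, whose determinant is B k k. *)
Lemma det_exch A K B k : k \notin K -> B *m exch_in A K = exch_out A K ->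
  \det (exch_in A (k |: K)) = B k k * \det (exch_in A K).
Proof.
move=> kK BE.
pose E : 'M[F]_m := \matrix_(i, j) if i == k then B k j else (i == j)%:R.
have -> : exch_in A (k |: K) = E *m exch_in A K.
  apply/matrixP => i l; rewrite [LHS]mxE in_setU1 mxE.
  have [->|ik] /= := eqVneq i k.
    transitivity ((B *m exch_in A K) k l); last first.
      by rewrite mxE; apply: eq_bigr => j _; rewrite [E k j]mxE eqxx.
    by rewrite BE mxE (negbTE kK).
  rewrite (bigD1 i)//= big1 => [|j ji]; last first.
    by rewrite [E i j]mxE (negbTE ik) eq_sym (negbTE ji) mul0r.
  by rewrite [E i i]mxE (negbTE ik) eqxx mul1r addr0 [RHS]mxE.
rewrite det_mulmx; congr (_ * _); rewrite (expand_det_row _ k).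
rewrite (eq_bigr (fun j => B k j * (\adj (1%:M : 'M[F]_m)) j k)); last first.
  move=> j _; rewrite [E k j]mxE eqxx; congr (_ * _).
  rewrite [RHS]mxE /cofactor; congr (_ * \det _).
  by apply/matrixP => a b; rewrite !mxE eq_sym (negbTE (neq_lift k a)).
rewrite adj1 (bigD1 k)//= big1 => [|j jk]; last first.
  by rewrite mxE (negbTE jk) mulr0.
by rewrite mxE eqxx mulr1 addr0.
Qed.

Lemma sweeps_exch A K B ks : uniq ks -> {in ks, forall k, k \notin K} ->
  all (fun p => p != 0) (pivots ks B) ->
  B *m exch_in A K = exch_out A K ->
  let K' := [set x in ks] :|: K in
  sweeps ks B *m exch_in A K' = exch_out A K' /\
  \det (exch_in A K') = \prod_(p <- pivots ks B) p * \det (exch_in A K).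
Proof.
elim: ks K B => [|k ks IH] K B /=.
  move=> _ _ _ BE; rewrite big_nil mul1r (_ : _ :|: K = K)//.
  by apply/setP => i; rewrite !inE.
move=> /andP[kks uks] ksK /andP[p0 ps] BE.
have kK : k \notin K by apply: ksK; rewrite mem_head.
have := IH (k |: K) (sweep k B) uks _ ps (sweep_exch kK p0 BE).
have -> : [set x in k :: ks] :|: K = [set x in ks] :|: (k |: K).
  by apply/setP => i; rewrite !inE orbCA orbA.
rewrite big_cons (det_exch kK BE).
move=> /(_ _)[].
  move=> i iks; rewrite in_setU1 negb_or ksK ?inE ?iks ?orbT// andbT.
  by apply: contraNneq kks => <-.
move=> -> ->; split => //; ring.
Qed.

Lemma exch_in0 A : exch_in A finset.set0 = 1%:M.
Proof. by apply/matrixP => i j; rewrite !mxE inE. Qed.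

Lemma exch_out0 A : exch_out A finset.set0 = A.
Proof. by apply/matrixP => i j; rewrite !mxE inE. Qed.

Lemma exch_inT A : exch_in A finset.setT = A.
Proof. by apply/matrixP => i j; rewrite !mxE inE. Qed.

Lemma exch_outT A : exch_out A finset.setT = - 1%:M.
Proof. by apply/matrixP => i j; rewrite !mxE inE. Qed.

(** When everything has been exchanged, the invariant reads
    [sweeps _ A *m A = - 1%:M]. *)
Lemma sweeps_all A : all (fun p => p != 0) (pivots (enum 'I_m) A) ->
  [/\ A \in unitmx, \det A = \prod_(p <- pivots (enum 'I_m) A) p &
      sweeps (enum 'I_m) A = - invmx A].
Proof.
move=> ps; have := @sweeps_exch A finset.set0 A (enum 'I_m) (enum_uniq _) _ ps.
rewrite exch_in0 exch_out0 mulmx1 => /(_ _ erefl)[].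
  by move=> k; rewrite inE.
have -> : ([set x in enum 'I_m] :|: finset.set0)%SET = finset.setT.
  by apply/setP => i; rewrite !inE mem_enum.
rewrite exch_inT exch_outT det1 mulr1 => swA dA.
have uA : A \in unitmx.
  rewrite unitmxE unitfE dA prodf_seq_neq0; apply: sub_all ps => p.
  by rewrite implyTb.
split => //.
by rewrite -[LHS](mulmxK uA) swA mulNmx mul1mx.
Qed.

End sweep.

(** * Positive definiteness in terms of pivots *)

Section positive_pivots.
Context (R : realType) (m : nat).
Implicit Types (A B : 'M[R]_m) (k : 'I_m) (ks : seq 'I_m)
  (x : 'cV[R]_m).

Definition qform (x : 'cV[R]_m) ks B : R :=
  \sum_(i <- ks) \sum_(j <- ks) x i ord0 * B i j * x j ord0.

(** Completing the square in the variable x_k: the part of the form that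
    remains in the other variables is the Schur complement of the pivot, and
    this is what the sweep leaves off row and column k. *)
Lemma qform_sweep x k ks B : k \notin ks -> B^T = B -> B k k != 0 ->
  qform x (k :: ks) B =
  (B k k * x k ord0 + \sum_(j <- ks) B k j * x j ord0) ^+ 2 / B k k
    + qform x ks (sweep k B).
Proof.
move=> kks BT p0; set s := \sum_(j <- ks) _.
have sE : \sum_(i <- ks) x i ord0 * B i k = s.
  by apply: eq_bigr => i _; rewrite mulrC -{1}BT mxE.
have -> : qform x ks (sweep k B) = qform x ks B - s ^+ 2 / B k k.
  rewrite expr2 -{1}sE mulr_suml mulr_suml -sumrB.
  apply: eq_big_seq => i iks; rewrite /s mulr_sumr mulr_suml -sumrB.
  apply: eq_big_seq => j jks; rewrite sweepE.
  have /negbTE-> : i != k by apply: contraNneq kks => <-.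
  have /negbTE-> : j != k by apply: contraNneq kks => <-.
  by rewrite mulrBr mulrBl; congr (_ - _); ring.
rewrite /qform big_cons big_cons.
under [X in _ + _ + X = _]eq_bigr do rewrite big_cons.
rewrite big_split /= -mulr_suml sE.
have -> : \sum_(j <- ks) x k ord0 * B k j * x j ord0 = x k ord0 * s.
  by rewrite mulr_sumr; apply: eq_bigr => j _; rewrite mulrA.
by field.
Qed.

(** The squares vanish together only at 0: if x vanishes on the indices swept
    after k, the square of k reduces to (B k k * x_k)^2. *)
Lemma qform_gt0 x ks B : uniq ks -> B^T = B ->
  all (fun p => 0 < p) (pivots ks B) ->
  (exists2 i, i \in ks & x i ord0 != 0) -> 0 < qform x ks B.
Proof.
elim: ks B => [|k ks IH] B /=; first by move=> _ _ _ [].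
move=> /andP[kks uks] BT /andP[p0 ps] [i iks xi0].
rewrite qform_sweep ?gt_eqF//.
have [/hasP[j jks xj0]|xks0] := boolP (has (fun j => x j ord0 != 0) ks).
  apply: ltr_wpDl; first by rewrite divr_ge0 ?sqr_ge0// ltW.
  by apply: IH => //; [exact: sweep_sym|exists j].
have {}xks0 j : j \in ks -> x j ord0 = 0.
  by move=> jks; apply/eqP; move/hasPn: xks0 => /(_ _ jks); rewrite negbK.
rewrite big_seq big1 => [|j /xks0->]; last by rewrite mulr0.
have -> : qform x ks (sweep k B) = 0.
  rewrite /qform big_seq big1 => // j /xks0 ->.
  by rewrite big1// => l _; rewrite !mul0r.
have xk0 : x k ord0 != 0.
  by move: iks; rewrite inE => /predU1P[<-//|/xks0 /eqP]; rewrite (negbTE xi0).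
by rewrite !addr0 divr_gt0// exprn_even_gt0//= mulf_neq0// gt_eqF.
Qed.

Lemma mx_qformE x A : (x^T *m A *m x) ord0 ord0 = qform x (enum 'I_m) A.
Proof.
rewrite -mulmxA mxE /qform [RHS]big_enum; apply: eq_bigr => i _.
rewrite !mxE mulr_sumr [RHS]big_enum; apply: eq_bigr => j _.
by rewrite mulrA.
Qed.

(** The pivot is a value of the quadratic form of A. Choose x whose exchanged
    input is the k-th basis vector e. Then x^T (A x) has a vanishing factor at
    every index other than k, x_k = 1, and (A x)_k is the k-th entry of the
    exchanged output B e, that is B k k. *)
Lemma posdef_pivot A (K : {set 'I_m}) B k : posdef A -> k \notin K ->
  \det (exch_in A K) != 0 -> B *m exch_in A K = exch_out A K -> 0 < B k k.
Proof.
move=> [AT A0] kK dZ BE.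
have uZ : exch_in A K \in unitmx by rewrite unitmxE unitfE.
pose e : 'cV[R]_m := delta_mx k ord0.
have [x Zx] : exists x, exch_in A K *m x = e.
  by exists (invmx (exch_in A K) *m e); rewrite mulKVmx.
have x0 : x != 0.
  apply: contraTneq isT => xE; move: Zx; rewrite xE mulmx0.
  move=> /matrixP/(_ k ord0); rewrite !mxE !eqxx => /eqP.
  by rewrite eq_sym oner_eq0.
have := A0 x x0; suff -> : (x^T *m A *m x) ord0 ord0 = B k k by [].
have -> : B k k = (A *m x) k ord0.
  transitivity ((B *m e) k ord0).
    rewrite mxE (bigD1 k)//= big1 => [|j jk]; last first.
      by rewrite !mxE (negbTE jk) mulr0.
    by rewrite mxE !eqxx mulr1 addr0.
  rewrite -Zx mulmxA BE !mxE; apply: eq_bigr => j _.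
  by rewrite exch_outE (negbTE kK).
rewrite -mulmxA mxE (bigD1 k)//= big1 => [|i ik].
  have -> : x^T ord0 k = 1; last by rewrite mul1r addr0.
  transitivity ((exch_in A K *m x) k ord0); last by rewrite Zx mxE !eqxx.
  rewrite !mxE (bigD1 k)//= big1 => [|j jk].
    by rewrite exch_inE (negbTE kK) eqxx mul1r addr0.
  by rewrite exch_inE (negbTE kK) eq_sym (negbTE jk) mul0r.
have Zi : (exch_in A K *m x) i ord0 = 0 by rewrite Zx mxE (negbTE ik).
have [iK|iK] := boolP (i \in K).
  have -> : (A *m x) i ord0 = 0; last by rewrite mulr0.
  by rewrite -Zi !mxE; apply: eq_bigr => j _; rewrite exch_inE iK.
have -> : x^T ord0 i = 0; last by rewrite mul0r.
rewrite -Zi !mxE (bigD1 i)//= big1 => [|j ji].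
  by rewrite exch_inE (negbTE iK) eqxx mul1r addr0.
by rewrite exch_inE (negbTE iK) eq_sym (negbTE ji) mul0r.
Qed.

Lemma posdef_pivots_gt0 A (K : {set 'I_m}) B ks : posdef A -> uniq ks ->
  {in ks, forall k, k \notin K} -> \det (exch_in A K) != 0 ->
  B *m exch_in A K = exch_out A K -> all (fun p => 0 < p) (pivots ks B).
Proof.
move=> Apos; elim: ks K B => //= k ks IH K B /andP[kks uks] ksK dZ BE.
have kK : k \notin K by apply: ksK; rewrite mem_head.
have p0 := posdef_pivot Apos kK dZ BE; rewrite p0 /=.
apply: (IH (k |: K)) => //.
- move=> i iks; rewrite in_setU1 negb_or ksK ?inE ?iks ?orbT// andbT.
  by apply: contraNneq kks => <-.
- by rewrite (det_exch kK BE) mulf_neq0// gt_eqF.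
- by apply: sweep_exch => //; rewrite gt_eqF.
Qed.

Lemma posdefP A : A^T = A ->
  posdef A <-> all (fun p => 0 < p) (pivots (enum 'I_m) A).
Proof.
move=> AT; split=> [Apos|ps].
  apply: (@posdef_pivots_gt0 A finset.set0 A) => //.
  - exact: enum_uniq.
  - by move=> k; rewrite inE.
  - by rewrite exch_in0 det1 oner_eq0.
  - by rewrite exch_in0 exch_out0 mulmx1.
split => // x x0; rewrite mx_qformE; apply: qform_gt0 => //.
  exact: enum_uniq.
have /cV0Pn[i xi] := x0.
by exists i => //; rewrite mem_enum.
Qed.

End positive_pivots.

(** * The Jacobian of a sweep *)

Section sweep_transport.
Context (R : realType) (m : nat).
Implicit Types (v : (symdim m).-tuple R) (k i j : 'I_m) (c : 'I_(symdim m)).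

Definition position c : 'I_m * 'I_m := val (enum_val c).

Definition coord_at i j : 'I_(symdim m) := enum_rank (utri_pair i j).

Lemma positionK c : coord_at (position c).1 (position c).2 = c.
Proof.
rewrite -[RHS]enum_valK; congr enum_rank; apply: val_inj => /=.
have -> : ((position c).1 <= (position c).2)%N by exact: (valP (enum_val c)).
by rewrite -surjective_pairing.
Qed.

Lemma coord_atK i j :
  position (coord_at i j) = if (i <= j)%N then (i, j) else (j, i).
Proof. by rewrite /position enum_rankK. Qed.

Lemma coord_atC i j : coord_at i j = coord_at j i.
Proof.
congr enum_rank; apply: val_inj => /=.
by case: (ltngtP i j) => // ij; congr (_, _); apply: val_inj.
Qed.

Lemma sym_mxE v i j : sym_mx v i j = tnth v (coord_at i j).
Proof. by rewrite mxE. Qed.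

Lemma tr_sym_mx v : (sym_mx v)^T = sym_mx v.
Proof. by apply/matrixP => i j; rewrite mxE !sym_mxE coord_atC. Qed.

Lemma tnth_sym_mx v c : tnth v c = sym_mx v (position c).1 (position c).2.
Proof. by rewrite sym_mxE positionK. Qed.

Lemma tnth_sym_coords (X : 'M[R]_m) c :
  tnth (sym_coords X) c = X (position c).1 (position c).2.
Proof. by rewrite tnth_mktuple. Qed.

Definition sweep_coords k v := sym_coords (sweep k (sym_mx v)).

Lemma sym_mx_sweep k v : sym_mx (sweep_coords k v) = sweep k (sym_mx v).
Proof. by rewrite sym_coordsK// sweep_sym// tr_sym_mx. Qed.

Lemma measurable_sym_mx i j :
  measurable_fun [set: (symdim m).-tuple R] (fun v => sym_mx v i j).
Proof.
under eq_fun do rewrite sym_mxE.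
exact: measurable_tnth.
Qed.

Lemma measurable_sweep_inv : measurable_fun [set: R] (@sweep_inv R).
Proof.
apply: measurable_fun_ifT => //; last exact: measurable_inv.
exact: measurable_fun_eqr.
Qed.

Let off_cross k := [seq c <- enum 'I_(symdim m)
               | ((position c).1 != k) && ((position c).2 != k)].

Let punctured_cross k := [seq coord_at i k | i <- enum (predC1 k)].

Let mem_off_cross k c :
  (c \in off_cross k) = ((position c).1 != k) && ((position c).2 != k).
Proof. by rewrite mem_filter mem_enum andbT. Qed.

Let mem_punctured_cross k c :
  (c \in punctured_cross k) = ((position c).1 == k) (+) ((position c).2 == k).
Proof.
apply/mapP/idP => [[i + ->]|].
  rewrite mem_enum inE => /negbTE ik.
  by rewrite coord_atK; case: ifP => _ /=; rewrite eqxx ik.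
have [c1|c1] := eqVneq (position c).1 k => /= c2.
  exists (position c).2; first by rewrite mem_enum.
  by rewrite coord_atC -c1 positionK.
exists (position c).1; first by rewrite mem_enum.
by rewrite -(eqP c2) positionK.
Qed.

Let eq_coord_at k c :
  (c == coord_at k k) = ((position c).1 == k) && ((position c).2 == k).
Proof.
apply/eqP/andP => [->|[/eqP c1 /eqP c2]].
  by rewrite coord_atK; case: ifP => _ /=; rewrite eqxx.
by rewrite -[LHS]positionK c1 c2.
Qed.

Let uniq_punctured_cross k : uniq (punctured_cross k).
Proof.
rewrite map_inj_in_uniq ?enum_uniq// => i j _ _ /(congr1 position).
rewrite !coord_atK; case: ifP => _; case: ifP => _ [] // ->.
  by move=> ->.
by move=> <-.
Qed.

Let size_punctured_cross k : size (punctured_cross k) = m.-1.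
Proof. by rewrite size_map -cardE cardC1 card_ord. Qed.

Let translation_off k c v : R :=
  - (sym_mx v (position c).1 k * sym_mx v k (position c).2 / sym_mx v k k).

(** The order matters: the translations of the entries off row k use the
    entries of row k before they are scaled, and the scalings use the pivot
    before it is inverted. Each stage is then affine with coefficients that it
    leaves fixed. *)
Lemma sweep_coordsE k v :
  sweep_coords k v =
  (fun w => upd w (coord_at k k) (- (tnth w (coord_at k k))^-1))
    (affine_on (punctured_cross k)
       (fun=> fun w => sweep_inv (tnth w (coord_at k k)))
       (fun=> cst 0)
       (affine_on (off_cross k) (fun=> cst 1) (translation_off k) v)).
Proof.
have kk_off : coord_at k k \in off_cross k = false.
  by rewrite mem_off_cross coord_atK leqnn /= eqxx.
have kk_cross : coord_at k k \in punctured_cross k = false.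
  by rewrite mem_punctured_cross coord_atK leqnn /= eqxx.
apply: eq_from_tnth => c; rewrite tnth_sym_coords sweepE !tnth_mktuple.
rewrite kk_off kk_cross mem_off_cross mem_punctured_cross eq_coord_at -sym_mxE.
rewrite (tnth_sym_mx v c).
have [->|c1] := eqVneq (position c).1 k;
  have [->|c2] := eqVneq (position c).2 k; rewrite //= ?addr0//.
by rewrite mul1r.
Qed.

(** The translations contribute 1, the m-1 scalings 1/|p| each, and the
    inversion of the pivot 1/p^2. *)
Lemma transports_sweep k : transports (@lebesgue_tuple R (symdim m))
  (sweep_coords k) (fun v => `|(sym_mx v k k)^-1| ^+ m.+1).
Proof.
have T1 : transports (@lebesgue_tuple R (symdim m))
    (affine_on (off_cross k) (fun=> cst 1) (translation_off k))
    (fun=> \prod_(c <- off_cross k) `|1|).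
  apply: (@transports_affine_on _ _ _ (fun=> cst 1)) => //.
  - exact/filter_uniq/enum_uniq.
  - move=> c; apply: measurableT_comp => //.
    apply: measurable_funM.
      by apply: measurable_funM; exact: measurable_sym_mx.
    by apply: measurableT_comp; [exact: measurable_inv|exact: measurable_sym_mx].
  - by move=> c v; exact: oner_neq0.
  - move=> c v w coff vw; split => //; rewrite /translation_off.
    have E i : sym_mx v i k = sym_mx w i k.
      rewrite !sym_mxE vw// mem_off_cross coord_atK.
      by case: ifP => _ /=; rewrite eqxx ?andbF.
    have E' i : sym_mx v k i = sym_mx w k i.
      by rewrite -(tr_sym_mx v) -(tr_sym_mx w) !(mxE, E).
    by rewrite !E E'.
have T2 : transports (@lebesgue_tuple R (symdim m))
    (affine_on (punctured_cross k)
       (fun=> fun w => sweep_inv (tnth w (coord_at k k)))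
       (fun=> cst 0))
    (fun w => \prod_(c <- punctured_cross k)
       `|sweep_inv (tnth w (coord_at k k))|).
  apply: transports_affine_on => //.
  - move=> c; apply: measurableT_comp; first exact: measurable_sweep_inv.
    exact: measurable_tnth.
  - by move=> c v; exact: sweep_inv_neq0.
  - move=> c v w cc vw; split => //; rewrite vw//.
    by rewrite mem_punctured_cross coord_atK leqnn /= eqxx.
have T3 := @transports_coord R (symdim m) (coord_at k k) (fun=> fun x => - x^-1)
  (fun=> fun x => x^-1 ^+ 2).
have mV : measurable_fun [set: (symdim m).-tuple R]
    (fun v => (tnth v (coord_at k k))^-1).
  by apply: measurableT_comp; [exact: measurable_inv|exact: measurable_tnth].
have {}T3 := T3 (measurableT_comp (@oppr_measurable R setT) mV)
  (measurable_funX 2 mV) (fun _ _ => erefl) (fun _ _ => erefl)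
  (fun=> transports_inv R).
have := transports_comp T1 (transports_comp T2 T3); congr (transports _ _ _).
  by apply/funext => v; rewrite sweep_coordsE.
apply/funext => v; rewrite [X in _ * X]big1_seq ?normr1// mulr1.
have kk_off : coord_at k k \in off_cross k = false.
  by rewrite mem_off_cross coord_atK leqnn /= eqxx.
have kk_cross : coord_at k k \in punctured_cross k = false.
  by rewrite mem_punctured_cross coord_atK leqnn /= eqxx.
rewrite tnth_mktuple kk_cross tnth_mktuple kk_off -sym_mxE.
rewrite big_const_seq count_predT size_punctured_cross iter_mulr_1.
(* At a zero pivot both sides vanish. *)
set x := sym_mx v k k; rewrite -[x^-1 ^+ 2]ger0_norm ?sqr_ge0// normrX.
have [->|x0] := eqVneq x 0; first by rewrite invr0 normr0 !expr0n mul0r.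
rewrite /sweep_inv (negbTE x0) -exprD; congr (_ ^+ _).
by rewrite add2n prednK// (leq_ltn_trans _ (ltn_ord k)).
Qed.

End sweep_transport.

(** * The Jacobian of matrix inversion *)

Section inversion.
Context (R : realType) (m : nat).
Implicit Types (v : (symdim m).-tuple R) (S : 'M[R]_m).

Lemma transports_sweeps (ks : seq 'I_m) :
  transports (@lebesgue_tuple R (symdim m))
    (fun v => sym_coords (sweeps ks (sym_mx v)))
    (fun v => `|(\prod_(p <- pivots ks (sym_mx v)) p)^-1| ^+ m.+1).
Proof.
elim: ks => [|k ks IH] /=.
  under eq_fun do rewrite sym_mxK.
  under [X in transports _ _ X]eq_fun do rewrite big_nil invr1 normr1 expr1n.
  exact: transports_id.
have := transports_comp (transports_sweep R k) IH; congr (transports _ _ _).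
  by apply/funext => v /=; rewrite sym_mx_sweep.
by apply/funext => v; rewrite sym_mx_sweep big_cons invfM normrM exprMn mulrC.
Qed.

Lemma transports_opp :
  transports (@lebesgue_tuple R (symdim m)) (fun v => sym_coords (- sym_mx v))
    (cst 1).
Proof.
have := @transports_affine_on R (symdim m) (enum 'I_(symdim m))
  (fun=> cst (-1)) (fun=> cst 0) (enum_uniq _) _ _ _ _.
move=> /(_ _ _ _ _)-[] //.
  by move=> c v; rewrite oppr_eq0 oner_eq0.
move=> mT mJ J0 E; have := Transports mT mJ J0 E; congr (transports _ _ _).
  apply/funext => v; apply: eq_from_tnth => c.
  rewrite tnth_mktuple mem_enum addr0 mulN1r.
  by rewrite tnth_sym_coords mxE -tnth_sym_mx.
by apply/funext => v; rewrite big1_seq// => c _; rewrite normrN1.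
Qed.

Lemma transports_inverse :
  transports (@lebesgue_tuple R (symdim m))
    (fun v => sym_coords (- sweeps (enum 'I_m) (sym_mx v)))
    (fun v => `|(\prod_(p <- pivots (enum 'I_m) (sym_mx v)) p)^-1| ^+ m.+1).
Proof.
have := transports_comp (transports_sweeps (enum 'I_m)) transports_opp.
congr (transports _ _ _); apply/funext => v /=; last by rewrite mul1r.
congr sym_coords; congr (- _); rewrite sym_coordsK//.
elim: (enum _) v => [|k ks IH] v /=; first exact: tr_sym_mx.
by rewrite -sym_mx_sweep; exact: IH.
Qed.

Lemma posdef_sym_mx v : posdef_coords v <->
  all (fun p => 0 < p) (pivots (enum 'I_m) (sym_mx v)).
Proof. exact/posdefP/tr_sym_mx. Qed.

(** Positivity of the quadratic form is a condition on uncountably many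
    vectors; positivity of the pivots turns it into finitely many. *)
Lemma measurable_posdef_coords : measurable (@posdef_coords R m).
Proof.
rewrite (_ : @posdef_coords R m =
    [set v | all (fun p => 0 < p) (pivots (enum 'I_m) (sym_mx v))]); last first.
  by apply/seteqP; split => v /posdef_sym_mx.
elim: (enum _) => [|k ks IH] /=.
  by rewrite (_ : [set _ | _] = setT)//; apply/seteqP; split.
rewrite (_ : [set _ | _] = [set v | 0 < sym_mx v k k] `&`
    sweep_coords k @^-1` [set v | all (fun p => 0 < p) (pivots ks (sym_mx v))]);
  last first.
  apply/seteqP; split => v /=; rewrite sym_mx_sweep; first by move=> /andP[].
  by move=> [-> ->].
apply: measurableI.
  rewrite (_ : [set _ | _] = (fun v => sym_mx v k k) @^-1` `]0, +oo[); last first.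
    by apply/seteqP; split => v /=; rewrite in_itv /= andbT.
  by rewrite -[X in measurable X]setTI; exact: measurable_sym_mx.
rewrite -[X in measurable X]setTI.
exact: (transports_measurable (transports_sweep R k)).
Qed.

Lemma posdef_pivots_neq0 S : posdef S ->
  all (fun p => p != 0) (pivots (enum 'I_m) S).
Proof.
move=> Spos; have := (posdefP Spos.1).1 Spos.
by apply: sub_all => p; exact: lt0r_neq0.
Qed.

Lemma posdef_unitmx S : posdef S -> S \in unitmx.
Proof. by move=> /posdef_pivots_neq0 /sweeps_all[]. Qed.

Lemma posdef_det_gt0 S : posdef S -> 0 < \det S.
Proof.
move=> Spos; have ps := (posdefP Spos.1).1 Spos.
have [_ -> _] := sweeps_all (posdef_pivots_neq0 Spos).
rewrite big_seq prodr_gt0// => p pp.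
exact: (allP ps).
Qed.

Lemma posdef_invmx S : posdef S -> posdef (invmx S).
Proof.
move=> Spos; have uS := posdef_unitmx Spos; have [ST S0] := Spos.
have IT : (invmx S)^T = invmx S by rewrite trmx_inv ST.
split => // x x0; have := S0 (invmx S *m x).
rewrite trmx_mul IT -!mulmxA mulKVmx//; apply.
by apply: contraNneq x0 => /(congr1 (mulmx S)); rewrite mulKVmx// mulmx0 => ->.
Qed.

Definition inv_coords v := sym_coords (invmx (sym_mx v)).

Lemma sym_mx_inv v : sym_mx (inv_coords v) = invmx (sym_mx v).
Proof. by rewrite sym_coordsK// trmx_inv tr_sym_mx. Qed.

Lemma inv_coordsK : involutive inv_coords.
Proof. by move=> v; rewrite /inv_coords sym_mx_inv invmxK sym_mxK. Qed.

Lemma posdef_coords_inv v : posdef_coords v -> posdef_coords (inv_coords v).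
Proof. by rewrite /posdef_coords /= sym_mx_inv; exact: posdef_invmx. Qed.

(** [transports_inverse] is applied to g extended by 0 outside the cone. The
    transported integrand vanishes outside the cone too: at such a matrix either
    a pivot is 0, and with it the Jacobian factor, or the matrix is invertible
    and its inverse is not positive definite either. *)
Lemma ge0_integral_posdef_invmx (g : (symdim m).-tuple R -> \bar R) :
  measurable_fun (@posdef_coords R m) g ->
  (forall v, posdef_coords v -> 0 <= g v)%E ->
  (\int[@lebesgue_tuple R (symdim m)]_(v in @posdef_coords R m)
     (g (inv_coords v) * ((\det (sym_mx v))^-1 ^+ m.+1)%:E) =
   \int[@lebesgue_tuple R (symdim m)]_(v in @posdef_coords R m) g v)%E.
Proof.
move=> mg g0.
have mD := measurable_posdef_coords.
rewrite [LHS]integral_mkcond [RHS]integral_mkcond.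
rewrite -[RHS](transportsE transports_inverse); last 2 first.
- exact/(measurable_restrictT _ mD).
- by move=> v; exact: erestrict_ge0.
apply: eq_integral => v _.
rewrite patchE; case: ifPn => [/set_mem vD|/negP vD].
  have [_ <- ->] := sweeps_all (posdef_pivots_neq0 vD).
  rewrite opprK -/(inv_coords v) patchE mem_set; last exact: posdef_coords_inv.
  by rewrite gtr0_norm// invr_gt0 posdef_det_gt0.
have [p0|p0] := eqVneq (\prod_(p <- pivots (enum 'I_m) (sym_mx v)) p) 0.
  by rewrite p0 invr0 normr0 expr0n mule0.
have [|_ _ ->] := @sweeps_all R m (sym_mx v).
  by move: p0; rewrite prodf_seq_neq0; apply: sub_all => p; rewrite implyTb.
rewrite opprK -/(inv_coords v) patchE ifN ?mul0e//.
apply/negP => /set_mem /posdef_coords_inv; rewrite inv_coordsK => vD'.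
by apply: vD; exact: mem_set.
Qed.

End inversion.

(** * Measurability of the determinant and of the inverse *)

Section measurability.
Context d (T : measurableType d) (R : realType).

Lemma measurable_det n (X : T -> 'M[R]_n) :
  (forall i j, measurable_fun [set: T] (fun w => X w i j)) ->
  measurable_fun [set: T] (fun w => \det (X w)).
Proof.
move=> mX; apply: measurable_sum => s; apply: measurable_funM => //.
by apply: measurable_prod => i _.
Qed.

Lemma measurable_invmx n (X : T -> 'M[R]_n) i j :
  (forall i j, measurable_fun [set: T] (fun w => X w i j)) ->
  measurable_fun [set: T] (fun w => invmx (X w) i j).
Proof.
move=> mX; have mdet := measurable_det mX.
rewrite (_ : (fun w => _) = fun w => if \det (X w) == 0 then X w i j
    else (\det (X w))^-1 * cofactor (X w) j i); last first.
  apply/funext => w; rewrite /invmx unitmxE unitfE.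
  by case: eqP => _ //=; rewrite !mxE.
apply: measurable_fun_ifT => //; first exact: measurable_fun_eqr.
apply: measurable_funM.
  by apply: measurableT_comp => //; exact: measurable_inv.
apply: measurable_funM => //; apply: measurable_det => k l.
by under eq_fun do rewrite !mxE; exact: mX.
Qed.

End measurability.

(** * Powers of a positive real number with complex exponents *)

Section complex_powers.
Context (R : realType).
Local Open Scope complex_scope.

Lemma cexpD (z w : R[i]) : cexp (z + w) = cexp z * cexp w.
Proof.
case: z w => [a b] [c e]; rewrite /cexp /= expRD cosD sinD.
by apply/eqP; rewrite eq_complex /=; apply/andP; split; apply/eqP; ring.
Qed.

Lemma cexp_real (x : R) : cexp x%:C = (expR x)%:C.
Proof.
rewrite /cexp /= cos0 sin0; apply/eqP.
by rewrite eq_complex /= !mulr1 !mulr0 !subr0 ?addr0 !eqxx.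
Qed.

Lemma rcpow_inv (x : R) (a : R[i]) (n : nat) : 0 < x ->
  rcpow x (- a - n%:R / 2) = rcpow x^-1 (a - n%:R / 2) * (x^-1 ^+ n)%:C.
Proof.
move=> x0; have -> : x^-1 ^+ n = expR (- (ln x *+ n)).
  by rewrite expRN -mulr_natl expRM_natl lnK ?posrE// exprVn.
rewrite -cexp_real /rcpow -cexpD lnV ?posrE//; congr cexp.
rewrite !rmorphN rmorphMn /= -mulr_natr.
by field.
Qed.

End complex_powers.

(** * The density of the inverse of a random matrix *)

Local Open Scope complex_scope.

Section inverse_density.
Context (R : realType) (m : nat) (aa bb : seq R[i]) (a : R[i])
  (Ups Xi : 'M[R[i]]_m).

Definition inv_hypergeom_gamma_pdf (S : 'M[R]_m) : R[i] :=
  detpow Xi a /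
    (mgamma m a * hypergeom (rcons aa a) bb (Ups *m invmx Xi)) *
  etr (- (Xi *m invmx (toC S))) *
  rcpow (\det S) (- a - m.+1%:R / 2) *
  hypergeom aa bb (Ups *m invmx (toC S)).

Lemma inv_hypergeom_gamma_pdfE (S : 'M[R]_m) : posdef S ->
  inv_hypergeom_gamma_pdf S =
  hypergeom_gamma_pdf aa bb a Ups Xi (invmx S) * ((\det S)^-1 ^+ m.+1)%:C.
Proof.
move=> Spos; rewrite /inv_hypergeom_gamma_pdf /hypergeom_gamma_pdf.
rewrite rcpow_inv ?posdef_det_gt0// det_inv.
have -> : toC (invmx S) = invmx (toC S) by exact: map_invmx.
rewrite -/(hypergeom_gamma_norm aa bb a Ups Xi).
by rewrite !mulrA [RHS]mulrAC.
Qed.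

End inverse_density.

Lemma eq_measure_ae d (T : measurableType d) (R : realType)
    (mu : {measure set T -> \bar R}) (A B : set T) :
  measurable A -> measurable B -> {ae mu, forall x, A x <-> B x} ->
  mu A = mu B.
Proof.
move=> mA mB AB; rewrite -[A]setIT -[B]setIT -!integral_indic//.
apply: ge0_ae_eq_integral => //.
- by apply/measurable_EFinP; exact: measurable_indic.
- by apply/measurable_EFinP; exact: measurable_indic.
- apply: filterS AB => x AB _; rewrite !indicE; congr (_%:R%:E).
  by congr nat_of_bool; apply/idP/idP; rewrite !inE; apply AB.
Qed.

(** The event that Y^-1 lies in B is, up to a null set, the event that Y lies
    in the inverse image of B; its probability is an integral of f, which
    inversion turns into an integral over B. *)
Lemma has_density_invmx (R : realType) (d : measure_display)
    (T : measurableType d) (P : probability T R) (m : nat) (Y : T -> 'M[R]_m)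
    (f g : 'M[R]_m -> R[i]) :
  (forall S, posdef S -> g S = f (invmx S) * ((\det S)^-1 ^+ m.+1)%:C) ->
  has_density P Y f -> has_density P (fun w => invmx (Y w)) g.
Proof.
move=> gE [mY Ypos f0 mf fY].
have ReM (z : R[i]) (x : R) : complex.Re (z * x%:C) = complex.Re z * x.
  by case: z => u v /=; rewrite mulr0 subr0.
have jac0 (S : 'M[R]_m) : posdef S -> 0 <= (\det S)^-1 ^+ m.+1.
  by move=> /posdef_det_gt0 dS; rewrite exprn_ge0// invr_ge0 ltW.
have mD := @measurable_posdef_coords R m.
have mI : measurable_fun [set: (symdim m).-tuple R] (@inv_coords R m).
  apply/measurable_fun_tnthP => c.
  rewrite (_ : _ \o _ =
      fun v => invmx (sym_mx v) (position c).1 (position c).2).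
    apply: measurable_invmx => i j; exact: measurable_sym_mx.
  by apply/funext => v; rewrite /= tnth_sym_coords.
have mjac : measurable_fun (@posdef_coords R m)
    (fun v => (\det (sym_mx v))^-1 ^+ m.+1).
  apply: measurable_funTS; apply: measurable_funX.
  apply: measurableT_comp; first exact: measurable_inv.
  by apply: measurable_det => i j; exact: measurable_sym_mx.
have mfI : measurable_fun (@posdef_coords R m)
    (fun v => complex.Re (f (sym_mx (inv_coords v)))).
  apply: (measurable_comp mD _ mf).
    by move=> _ [v vD <-]; exact: posdef_coords_inv.
  exact: measurable_funTS.
have gfE v : posdef_coords v -> complex.Re (g (sym_mx v)) =
    complex.Re (f (sym_mx (inv_coords v))) * (\det (sym_mx v))^-1 ^+ m.+1.
  by move=> vD; rewrite gE// ReM sym_mx_inv.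
split.
- by move=> i j; exact: measurable_invmx.
- by apply: filterS Ypos => w; exact: posdef_invmx.
- move=> S Spos; rewrite gE// mulr_ge0 ?f0//; first exact: posdef_invmx.
  by rewrite lecR jac0.
- apply: (eq_measurable_fun (fun v => complex.Re (f (sym_mx (inv_coords v))) *
    (\det (sym_mx v))^-1 ^+ m.+1)).
    by move=> v /set_mem vD; rewrite gfE.
  exact: measurable_funM.
- move=> B mB.
  have mBI : measurable (@inv_coords R m @^-1` B).
    by rewrite -[X in measurable X]setTI; exact: mI.
  have mYc : measurable_fun [set: T] (fun w => sym_coords (Y w)).
    apply/measurable_fun_tnthP => c.
    rewrite (_ : _ \o _ = fun w => Y w (position c).1 (position c).2)//.
    by apply/funext => w /=; rewrite tnth_sym_coords.
  have mIYc : measurable_fun [set: T] (fun w => sym_coords (invmx (Y w))).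
    apply/measurable_fun_tnthP => c.
    rewrite (_ : _ \o _ = fun w => invmx (Y w) (position c).1 (position c).2).
      exact: measurable_invmx.
    by apply/funext => w /=; rewrite tnth_sym_coords.
  have -> : P ((fun w => sym_coords (invmx (Y w))) @^-1` B) =
      P ((fun w => sym_coords (Y w)) @^-1` (@inv_coords R m @^-1` B)).
    apply: eq_measure_ae.
    + by rewrite -[X in measurable X]setTI; exact: mIYc.
    + by rewrite -[X in measurable X]setTI; exact: mYc.
    + apply: filterS Ypos => w [YT _].
      by rewrite /= /inv_coords sym_coordsK.
  rewrite fY// !(setIC _ (@posdef_coords R m)).
  rewrite !(integral_mkcondr _ (@posdef_coords R m)).
  rewrite -[LHS]ge0_integral_posdef_invmx; last 2 first.
  + rewrite -measurable_restrict//.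
    by apply/measurable_EFinP; apply: measurable_funS mf => //; exact: subIsetl.
  + move=> v vD; rewrite patchE; case: ifP => // _; rewrite lee_fin.
    by have := f0 _ vD; rewrite lecE => /andP[].
  apply: eq_integral => v /set_mem vD; rewrite !patchE.
  have -> : (inv_coords v \in @inv_coords R m @^-1` B) = (v \in B).
    by apply/idP/idP; rewrite !inE /= inv_coordsK.
  by case: ifP => _; rewrite ?mul0e// gfE// EFinM.
Qed.

Theorem lemma2p2 (R : realType) (d : measure_display) (T : measurableType d)
    (P : probability T R) (m p q : nat) (m_gt0 : (0 < m)%N)
    (aa : p.-tuple R[i]) (bb : q.-tuple R[i]) (a : R[i])
    (Ups Xi : 'M[R[i]]_m) (Y : T -> 'M[R]_m)
    (Ups_sym : Ups^T = Ups)
    (Xi_sym : Xi^T = Xi)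
    (Xi_re : posdef (map_mx (@complex.Re R) Xi))
    (a_re : (m%:R - 1) / 2 < complex.Re a)
    (bb_def : Zonal.hypergeom_defined m bb)
    (cvg_pFq : forall S : 'M[R]_m, posdef S ->
       hypergeom_cvg aa bb (Ups *m toC S))
    (cvg_norm : hypergeom_cvg (rcons aa a) bb (Ups *m invmx Xi))
    (Y_dist : has_density P Y (hypergeom_gamma_pdf aa bb a Ups Xi)) :
  has_density P (fun w => invmx (Y w))
    (fun S : 'M[R]_m =>
       detpow Xi a /
         (mgamma m a * hypergeom (rcons aa a) bb (Ups *m invmx Xi)) *
       etr (- (Xi *m invmx (toC S))) *
       rcpow (\det S) (- a - m.+1%:R / 2) *
       hypergeom aa bb (Ups *m invmx (toC S))).
Proof.
apply: has_density_invmx Y_dist => S Spos.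
exact: inv_hypergeom_gamma_pdfE.
Qed.
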